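(* (Bolzano–Weierstrass Theorem.) For all $\gamma\in\omega^\omega$: if $\forall\zeta\in[\omega]^\omega\,\exists n\big[\frac{1}{2^n}<|q_{\gamma(\zeta(n))}-q_{\gamma(\zeta(n+1))}|\big]$, then $\exists n[1<|q_{\gamma(n)}|]$.
   Context: Setting: intuitionistic mathematics (intuitionistic logic), assuming the axioms of countable choice and Brouwer's Bar Theorem in the form of Bar Induction: if $B,C\subseteq\omega$, $B$ is a bar in $\omega^\omega$ (i.e. $\forall\alpha\exists n[\langle\alpha(0),\dots,\alpha(n-1)\rangle\in B]$, finite sequences coded by numbers), $B\subseteq C$ and $\forall s[s\in C\leftrightarrow\forall n[s\ast\langle n\rangle\in C]]$, then $\langle\,\rangle\in C$. $q_0,q_1,\dots$ is a fixed enumeration of the rationals $\mathbb{Q}$. $[\omega]^\omega=\{\zeta\in\omega^\omega\mid\forall n[\zeta(n)<\zeta(n+1)]\}$. *)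

(* Defs.v *)
From mathcomp Require Import all_boot all_order all_algebra.
Set Implicit Arguments.
Unset Strict Implicit.
Unset Printing Implicit Defensive.
Import Order.TTheory GRing.Theory Num.Theory.

(* Logic is that of Prop, i.e. intuitionistic; the non-logical principles
   are propositions, to be used as explicit hypotheses. *)

(* Choice along nat: A := nat and A := nat -> nat give the axioms usually
   called AC_{0,0} and AC_{0,1}. *)
Definition countable_choice (A : Type) : Prop :=
  forall R : nat -> A -> Prop,
    (forall n, exists a, R n a) -> exists f : nat -> A, forall n, R n (f n).

(* Finite sequences of numbers are elements of seq nat rather than codes in
   nat. *)
Definition is_bar (B : seq nat -> Prop) : Prop :=
  forall alpha : nat -> nat, exists n, B (mkseq alpha n).

(* The equivalence says that C is both monotone (left to right) and inductive
   (right to left); B itself need be neither monotone nor decidable. *)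
Definition bar_induction : Prop :=
  forall B C : seq nat -> Prop,
    is_bar B ->
    (forall s, B s -> C s) ->
    (forall s, C s <-> forall n, C (rcons s n)) ->
    C [::].

(* Repetitions are allowed. *)
Definition enumeration (T : Type) (q : nat -> T) : Prop :=
  forall x, exists n, q n = x.

Definition strictly_increasing (zeta : nat -> nat) : Prop :=
  forall n, zeta n < zeta n.+1.

(* Main.v *)
Require Import Defs.
From mathcomp Require Import all_boot all_order all_algebra.
From mathcomp Require Import lra.
Import Order.TTheory GRing.Theory Num.Theory.
Local Open Scope ring_scope.

(** Write [P] for the conclusion.  In the classical bisection argument replace
    falsity by [P] throughout, so that every case distinction between the two
    halves of an interval becomes available while [P] is being proved.  A finite
    sequence of indices that satisfies the fast Cauchy condition and ends in an
    interval visited infinitely often (relative to [P]) then extends to a longer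
    one of the same kind; bar induction along the bar of sequences that violate
    the condition turns this into a proof of [P]. *)

(** Bar induction is applied to the sequences all of whose extensions lie in [C]: this set is
    monotone by construction and contains [B] because [B] is monotone. *)
Lemma monotone_bar_induction (bi : bar_induction) (B C : seq nat -> Prop) :
  is_bar B ->
  (forall s n, B s -> B (rcons s n)) ->
  (forall s, B s -> C s) ->
  (forall s, (forall n, C (rcons s n)) -> C s) ->
  C [::].
Proof.
move=> barB monB subBC indC.
suff /(_ [::]) : forall t, C ([::] ++ t) by [].
apply: (bi B (fun s => forall t, C (s ++ t))) => // [s Bs t|s].
  apply: subBC; elim/last_ind: t => [|t n IHt]; first by rewrite cats0.
  by rewrite -rcons_cat; apply: monB.
split=> [Cs n t|Cs [|n t]]; first by rewrite cat_rcons.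
  by rewrite cats0; apply: indC => n; rewrite -[rcons s n]cats0.
by rewrite -cat_rcons.
Qed.

(** A bar must meet every [alpha], but the gap hypothesis covers increasing sequences only; this one
    is increasing and follows [alpha] until [alpha] first fails to increase. *)
Fixpoint strict_majorant (alpha : nat -> nat) (n : nat) : nat :=
  if n is m.+1 then maxn (alpha n) (strict_majorant alpha m).+1 else alpha 0%N.

Lemma strict_majorant_increasing (alpha : nat -> nat) :
  strictly_increasing (strict_majorant alpha).
Proof. by move=> n; rewrite /= leq_maxr. Qed.

Lemma strict_majorant_id (alpha : nat -> nat) (n : nat) :
  (forall i, (i <= n)%N -> strict_majorant alpha i = alpha i) \/
  (exists2 i, (i < n)%N & (alpha i.+1 <= alpha i)%N).
Proof.
elim: n => [|n [IHn|[i lt_in le_i]]]; first by left; case.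
  have [le_n|lt_n] := leqP (alpha n.+1) (alpha n); first by right; exists n.
  left=> i; rewrite leq_eqVlt => /predU1P[->|]; last exact: IHn.
  by rewrite /= IHn //; apply/maxn_idPl.
by right; exists i => //; apply: ltnW.
Qed.

Section BolzanoWeierstrass.

Variables (R : realFieldType) (x : nat -> R).

Definition violation (s : seq nat) (i : nat) : bool :=
  (nth 0 s i.+1 <= nth 0 s i)%N ||
  (1 / 2 ^+ i < `|x (nth 0 s i) - x (nth 0 s i.+1)|).

Definition violated (s : seq nat) : Prop :=
  exists2 i, (i.+1 < size s)%N & violation s i.

Lemma violation_rcons (s : seq nat) (n i : nat) :
  (i.+1 < size s)%N -> violation (rcons s n) i = violation s i.
Proof. by move=> lt_i; rewrite /violation !nth_rcons lt_i (ltnW lt_i). Qed.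

Lemma violated_rcons (s : seq nat) (n : nat) :
  violated s -> violated (rcons s n).
Proof.
case=> i lt_i vi; exists i; first by rewrite size_rcons ltnS ltnW.
by rewrite violation_rcons.
Qed.

Lemma violated_bar :
  (forall zeta : nat -> nat, strictly_increasing zeta ->
     exists n, 1 / 2 ^+ n < `|x (zeta n) - x (zeta n.+1)|) ->
  is_bar violated.
Proof.
move=> gap alpha; have [n gap_n] := gap _ (strict_majorant_increasing alpha).
(* A violation at [n] involves the entries [n] and [n.+1], hence a prefix of length [n.+2]. *)
have [eq_n|[i lt_in le_i]] := strict_majorant_id alpha n.+1; exists n.+2.
  exists n; rewrite ?size_mkseq // /violation !nth_mkseq //.
  by rewrite -!eq_n // gap_n orbT.
by exists i; rewrite ?size_mkseq // /violation !nth_mkseq ?le_i // ltnW.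
Qed.

(** With this width, level 0 fits the interval from -1 to 1, and level [k.+1] gives the bound
    [1 / 2 ^+ k] required of the entries [k] and [k.+1]. *)
Definition dyadic (a : R) (k : nat) (y : R) : bool := a <= y <= a + 2 / 2 ^+ k.

Lemma dyadic_width (k : nat) : 2 / 2 ^+ k.+1 = 1 / 2 ^+ k :> R.
Proof. by rewrite exprS invfM mulrA divff ?pnatr_eq0. Qed.

Lemma dyadicS (a : R) (k : nat) (y : R) :
  dyadic a k y = dyadic a k.+1 y || dyadic (a + 1 / 2 ^+ k) k.+1 y.
Proof.
rewrite /dyadic dyadic_width.
have : 0 < 1 / 2 ^+ k :> R by rewrite divr_gt0 ?exprn_gt0.
have -> : 2 / 2 ^+ k = 1 / 2 ^+ k + 1 / 2 ^+ k :> R by lra.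
move: (1 / 2 ^+ k) => w w_gt0.
by apply/idP/orP => [/andP[]|[]/andP[]]; have [] := leP y (a + w); lra.
Qed.

Lemma dyadic_dist (a : R) (k : nat) (y z : R) :
  dyadic a k.+1 y -> dyadic a k.+1 z -> `|y - z| <= 1 / 2 ^+ k.
Proof.
by rewrite /dyadic dyadic_width ler_norml; lra.
Qed.

Variable P : Prop.

(* With [P] in the place of falsity this is the negative translation of
   "[x n] lies in [J] for infinitely many [n]". *)
Definition often (J : R -> bool) : Prop :=
  forall m, (forall n, (m <= n)%N -> J (x n) -> P) -> P.

Lemma oftenU (J J1 J2 : R -> bool) :
  (forall y, J y = J1 y || J2 y) ->
  often J -> (often J1 -> P) -> (often J2 -> P) -> P.
Proof.
move=> JE oftJ P1 P2; apply: P1 => m1 P1; apply: P2 => m2 P2.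
apply: (oftJ (maxn m1 m2)) => n; rewrite geq_max => /andP[le1 le2].
by rewrite JE => /orP[]; [apply: P1 | apply: P2].
Qed.

(** The equation [i.+1 = size s] singles out the last entry, so the empty sequence needs no separate
    case. *)
Definition extendible (s : seq nat) : Prop :=
  (forall i, (i.+1 < size s)%N -> ~~ violation s i) /\
  exists2 a, often (dyadic a (size s)) &
    forall i, i.+1 = size s -> dyadic a (size s) (x (nth 0 s i)).

Lemma extendible_step (s : seq nat) :
  (forall n, extendible (rcons s n) -> P) -> extendible s -> P.
Proof.
move=> extP [ok_s [a often_a last_a]].
(* From a half visited often, an index past the last entry of [s] can be appended: the old last
   value and the new one share the interval around that half, hence are close enough. *)
have half b : (forall y, dyadic b (size s).+1 y -> dyadic a (size s) y) ->
    often (dyadic b (size s).+1) -> P.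
  move=> sub_ba often_b; apply: (often_b (last 0 s).+1) => n lt_n b_n.
  apply: (extP n); split=> [i|]; last first.
    exists b; rewrite size_rcons // => i [->].
    by rewrite nth_rcons ltnn eqxx.
  rewrite size_rcons ltnS leq_eqVlt => /predU1P[szs|lt_i]; last first.
    by rewrite violation_rcons // ok_s.
  rewrite /violation !nth_rcons szs ltnn eqxx -szs leqnn negb_or -ltnNge -leNgt.
  move: (last_a i szs) (sub_ba _ b_n) lt_n; rewrite -nth_last -szs /=.
  by move=> a_i a_n ->; apply: dyadic_dist a_i a_n.
apply: (oftenU _ _ _ (dyadicS a _) often_a).
  by apply: half => y half_y; rewrite dyadicS half_y.
by apply: half => y half_y; rewrite dyadicS half_y orbT.
Qed.

End BolzanoWeierstrass.

Lemma bolzano_weierstrass (bi : bar_induction) (R : realFieldType)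
    (x : nat -> R) :
  (forall zeta : nat -> nat, strictly_increasing zeta ->
     exists n, 1 / 2 ^+ n < `|x (zeta n) - x (zeta n.+1)|) ->
  exists n, 1 < `|x n|.
Proof.
move=> gap; set P := exists n, _.
suff : extendible R x P [::] -> P.
  (* Bisection starts from the interval from -1 to 1, since a term outside it already proves [P]. *)
  apply; split=> //; exists (- 1) => // m Pm.
  have [le1|gt1] := leP `|x m| 1; last by exists m.
  by apply: (Pm m) => //; move: le1; rewrite ler_norml /dyadic expr0; lra.
apply: (monotone_bar_induction bi (violated R x)
  (fun s => extendible R x P s -> P)).
- exact: violated_bar.
- exact: violated_rcons.
- by move=> s [i lt_i vi] [/(_ i lt_i)]; rewrite vi.
- exact: extendible_step.
Qed.

Theorem theorem7p15
  (ac00 : countable_choice nat)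
  (ac01 : countable_choice (nat -> nat))
  (bi : bar_induction)
  (q : nat -> rat) (q_enum : enumeration q)
  (gamma : nat -> nat) :
  (forall zeta : nat -> nat, strictly_increasing zeta ->
     exists n : nat,
       1 / 2 ^+ n < `|q (gamma (zeta n)) - q (gamma (zeta n.+1))|) ->
  exists n : nat, 1 < `|q (gamma n)|.
Proof. exact: (bolzano_weierstrass bi rat (fun n => q (gamma n))). Qed.
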